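(* Let $K$ be a field, $R=K[x_1,\ldots,x_n]$, and let $G$ be a bipartite graph with vertex set $\{1,\ldots,n\}$ and cover ideal $J(G)\subseteq R$. Then $\operatorname{reg} J(G)^s$ is a linear function in $s$ for all $s\geqslant n+2$; that is, there are integers $d$ and $e$ such that $\operatorname{reg} J(G)^s=ds+e$ for all integers $s\geqslant n+2$.
   Context: $R=K[x_1,\ldots,x_n]$ carries the standard grading and $\mathfrak{m}=(x_1,\ldots,x_n)$. For a finitely generated graded $R$-module $M$ and $i=0,\ldots,\dim M$, $a_i(M)=\max\{t\in\mathbb{Z}\mid H^i_{\mathfrak{m}}(M)_t\neq 0\}$ (with $\max\emptyset=-\infty$), where $H^i_{\mathfrak{m}}(M)$ is the $i$-th local cohomology module with support in $\mathfrak{m}$. The Castelnuovo-Mumford regularity is $\operatorname{reg}(M)=\max\{a_i(M)+i\mid i=0,\ldots,\dim M\}$. A vertex cover of $G$ is a set of vertices meeting every edge; it is minimal if no proper subset is a vertex cover. The cover ideal is $J(G)=(\prod_{i\in\tau}x_i\mid \tau\text{ a minimal vertex cover of }G)$; equivalently $J(G)=\bigcap_{\{i,j\}\text{ edge of }G}(x_i,x_j)$. $J(G)^s$ is the ordinary $s$-th power. *)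

(* Defs.v *)
From HB Require Import structures.
From mathcomp Require Import all_boot all_order all_algebra fraction.
From mathcomp Require Export mpoly.

Set Implicit Arguments.
Unset Strict Implicit.
Unset Printing Implicit Defensive.

Import Order.TTheory GRing.Theory Num.Theory.
Local Open Scope ring_scope.

Section Graphs.
Variable n : nat.

Definition simple_graph (E : rel 'I_n) : Prop :=
  ssrbool.symmetric E /\ irreflexive E.

Definition bipartite (E : rel 'I_n) : Prop :=
  exists A : {set 'I_n}, forall i j, E i j -> (i \in A) != (j \in A).

Definition vertex_cover (E : rel 'I_n) (C : {set 'I_n}) : bool :=
  [forall i, forall j, E i j ==> (i \in C) || (j \in C)].

Definition minimal_vertex_cover (E : rel 'I_n) (C : {set 'I_n}) : bool :=
  minset (vertex_cover E) C.

End Graphs.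

Section Ideals.
Variable R : comNzRingType.

Definition ideal_gen (S : R -> Prop) (f : R) : Prop :=
  exists s : seq (R * R),
    (forall p, p \in s -> S p.2) /\ f = \sum_(p <- s) p.1 * p.2.

Definition ideal_pow (I : R -> Prop) (s : nat) : R -> Prop :=
  ideal_gen (fun f => exists u : 'I_s -> R,
    (forall i, I (u i)) /\ f = \prod_(i < s) u i).

Definition is_ideal (I : R -> Prop) : Prop :=
  [/\ I 0, forall f g, I f -> I g -> I (f + g) & forall f g, I g -> I (f * g)].

Definition prime_ideal (P : R -> Prop) : Prop :=
  [/\ is_ideal P, ~ P 1 & forall f g, P (f * g) -> P f \/ P g].

Definition annihilator (I : R -> Prop) (f : R) : Prop :=
  forall g, I g -> f * g = 0.

(* [dim_ge I i] is [i <= dim I], the Krull dimension of [I] as an [R]-module,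
   i.e. that of [R / Ann I]: there is a chain [P 0 < ... < P i] of primes
   containing [Ann I]. *)
Definition dim_ge (I : R -> Prop) (i : nat) : Prop :=
  exists P : nat -> R -> Prop,
    [/\ forall j, (j <= i)%N -> prime_ideal (P j),
        forall j, (j <= i)%N -> forall f, annihilator I f -> P j f,
        forall j, (j < i)%N -> forall f, P j f -> P j.+1 f
      & forall j, (j < i)%N -> exists2 f, P j.+1 f & ~ P j f].

End Ideals.

(* Graded local cohomology, with support in the irrelevant maximal ideal
   m = (x_1, ..., x_n), of a homogeneous ideal I regarded as a graded module,
   computed by the Cech complex on x_1, ..., x_n

     C^i = \bigoplus_(F, #|F| = i) I_{x_F},     x_F = \prod_(j in F) x_j.

   As R is a domain, each I_{x_F} is a submodule of the fraction field. *)
Section LocalCohomology.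
Variables (K : fieldType) (n : nat).
Local Notation R := {mpoly K[n]}.
Local Notation cochains := {ffun {set 'I_n} -> {fraction R}}.

(* Unlike [d.-homog], the degree is an integer: in negative degree only 0 is
   homogeneous. *)
Definition homog_of_deg (t : int) (f : R) : Prop :=
  forall m, m \in msupp f -> (mdeg m)%:Z = t.

Definition monom (F : {set 'I_n}) : R := \prod_(j in F) 'X_j.

(* The component of degree t of I_{x_F}. *)
Definition loc_deg (I : R -> Prop) (F : {set 'I_n}) (t : int)
    (z : {fraction R}) : Prop :=
  exists k : nat, exists f : R,
    [/\ I f, homog_of_deg (t + (k * #|F|)%N%:Z) f
      & z = tofrac f / tofrac (monom F ^+ k)].

Definition cech_cochain (I : R -> Prop) (i : nat) (t : int) (c : cochains) :
    Prop :=
  forall F : {set 'I_n}, if #|F| == i then loc_deg I F t (c F) else c F = 0.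

Definition cech_diff (c : cochains) : cochains :=
  [ffun F : {set 'I_n} =>
     \sum_(j in F) (-1) ^+ #|[set k in F | (k < j)%N]| * c (F :\ j)].

Definition cech_cocycle (I : R -> Prop) (i : nat) (t : int) (c : cochains) :
    Prop :=
  cech_cochain I i t c /\ cech_diff c = 0.

Definition cech_coboundary (I : R -> Prop) (i : nat) (t : int)
    (c : cochains) : Prop :=
  if i is i'.+1 then exists2 b, cech_cochain I i' t b & cech_diff b = c
  else c = 0.

(* H^i_m(I)_t <> 0 *)
Definition loc_coh_neq0 (I : R -> Prop) (i : nat) (t : int) : Prop :=
  exists2 c, cech_cocycle I i t c & ~ cech_coboundary I i t c.

(* a_i(I) = a, where [None] stands for -oo. *)
Definition is_a_inv (I : R -> Prop) (i : nat) (a : option int) : Prop :=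
  if a is Some t then
    loc_coh_neq0 I i t /\ forall t', loc_coh_neq0 I i t' -> t' <= t
  else forall t, ~ loc_coh_neq0 I i t.

(* reg I = r, i.e. r = max {a_i(I) + i | 0 <= i <= dim I}. *)
Definition is_reg (I : R -> Prop) (r : int) : Prop :=
  (exists i t, [/\ dim_ge I i, is_a_inv I i (Some t) & r = t + i%:Z]) /\
  (forall i, dim_ge I i -> exists2 a, is_a_inv I i a &
     if a is Some t then t + i%:Z <= r else True).

Definition cover_ideal (E : rel 'I_n) : R -> Prop :=
  ideal_gen (fun f => exists2 C, minimal_vertex_cover E C & f = monom C).

End LocalCohomology.

Arguments cover_ideal K {n} E.

(* Main.v *)
Require Import Defs.
From mathcomp Require Import all_boot all_order all_algebra fraction zify.
From Stdlib Require Import Classical.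

(** For bipartite [E], the power [J^s] is spanned by the monomials [m] with
[s <= m i + m j] on every edge.  Hence the component of [I_{x_F}] of multidegree
[a] is [K] or [0], and is [K] exactly when [F] contains every [j] with [a j < 0]
and covers every edge with [a i + a j < s]; the Cech complex splits into the
cochain complexes of these up-closed families of sets.

Let [A] be one side of the bipartition.  If the family of [a] is not acyclic,
the nonnegative entries of [a] are at most [s - 1], and their sum is the sum over
[t < s - 1] of the cardinals of the threshold sets
[{i in A | t < a i} + {j notin A | s - 1 - t <= a j}].  By non-acyclicity each
threshold set lies in a minimal vertex cover, so it has at most [d] elements, [d]
being the largest size of a minimal cover.  Adding the indicator of a threshold
set of size [d] to [a] gives a multidegree for [s + 1] with the same family;
subtracting the indicator of a suitable threshold set goes back.  As [d * s] is
always attained, the maximum of [|a| + i] grows by exactly [d] from [s] to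
[s + 1] as soon as [n + 2 <= s]. *)

Set Implicit Arguments.
Unset Strict Implicit.
Unset Printing Implicit Defensive.

Import Order.TTheory GRing.Theory Num.Theory.
Local Open Scope ring_scope.

(** * Cochains on families of sets, and criteria for acyclicity *)

Section SetCochains.
Variables (n : nat) (V : pzRingType).
Implicit Types (F G : {set 'I_n}) (D : {set {set 'I_n}}) (c b : {set 'I_n} -> V).

Definition nbelow F (j : 'I_n) : nat := #|[set k in F | (k < j)%N]|.

Definition sdiff c F : V := \sum_(j in F) (-1) ^+ nbelow F j * c (F :\ j).

Lemma sdiffD c b F : sdiff (fun G => c G + b G) F = sdiff c F + sdiff b F.
Proof. by rewrite -big_split /=; apply: eq_bigr => j _; rewrite mulrDr. Qed.

Lemma sdiffN c F : sdiff (fun G => - c G) F = - sdiff c F.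
Proof. by rewrite /sdiff -sumrN; apply: eq_bigr => j _; rewrite mulrN. Qed.

Lemma nbelow_rem F (j l : 'I_n) :
  j \in F -> l \in F -> nbelow F l = (nbelow (F :\ j) l + (j < l))%N.
Proof.
move=> jF lF; rewrite /nbelow.
have -> : [set k in F :\ j | (k < l)%N] = [set k in F | (k < l)%N] :\ j.
  by apply/setP => k; rewrite !inE andbA.
by rewrite (cardsD1 j [set k in F | (k < l)%N]) !inE jF /= addnC.
Qed.

(** The terms for [(j, l)] and [(l, j)] cancel: removing the smaller index lowers [nbelow] of the
    larger one by one, but not conversely. *)
Lemma sdiff_sdiff c F : sdiff (sdiff c) F = 0.
Proof.
pose t j l := (-1) ^+ nbelow F j * ((-1) ^+ nbelow (F :\ j) l * c (F :\ j :\ l)).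
have -> : sdiff (sdiff c) F = \sum_(j in F) \sum_(l in F | l != j) t j l.
  apply: eq_bigr => j _; rewrite mulr_sumr; apply: eq_bigl => l.
  by rewrite !inE andbC.
have tN j l : j \in F -> l \in F -> (j < l)%N -> t l j = - t j l.
  move=> jF lF jl; rewrite /t (nbelow_rem jF lF) (nbelow_rem lF jF) jl.
  rewrite ltnNge (ltnW jl) /= addn0 addn1 exprS mulN1r !mulNr; congr (- _).
  rewrite !mulrA -!exprD addnC; congr (_ * c _).
  by apply/setP => k; rewrite !inE; case: (k == j); case: (k == l).
have -> : \sum_(j in F) \sum_(l in F | l != j) t j l =
    \sum_(j in F) \sum_(l in F | (l < j)%N) t j l +
    \sum_(j in F) \sum_(l in F | (j < l)%N) t j l.
  rewrite -big_split /=; apply: eq_bigr => j jF.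
  rewrite (bigID (fun l : 'I_n => (l < j)%N)) /=; congr (_ + _).
    by apply: eq_bigl => l; rewrite -val_eqE /=; case: ltngtP; rewrite ?andbT ?andbF.
  by apply: eq_bigl => l; rewrite -val_eqE /=; case: ltngtP; rewrite ?andbT ?andbF.
rewrite (exchange_big_dep (fun l => l \in F)) /=; last by move=> i j _ /andP[].
rewrite -big_split /= big1 // => j jF.
rewrite (eq_bigl (fun l : 'I_n => (l \in F) && (j < l)%N)); last first.
  by move=> l; rewrite jF.
rewrite -big_split big1 //= => l /andP[lF jl].
by rewrite tN // addNr.
Qed.

Definition supported D c := forall F, c F != 0 -> F \in D.

Lemma supp0 D c F : supported D c -> F \notin D -> c F = 0.
Proof. by move=> s /negP h; apply/eqP/negPn/negP => /s. Qed.

(* The complex spanned by a family of sets [D]: the differential is truncated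
   to [D], which squares to zero as soon as [D] is convex. *)
Definition acyclic D := forall c, supported D c ->
  (forall F, F \in D -> sdiff c F = 0) ->
  exists2 b, supported D b & forall F, F \in D -> sdiff b F = c F.

Definition convex D :=
  forall F G H, F \in D -> H \in D -> F \subset G -> G \subset H -> G \in D.

Definition trunc D c F : V := if F \in D then c F else 0.

Lemma supp_trunc D c : supported D (trunc D c).
Proof. by move=> F; rewrite /trunc; case: ifP => //; rewrite eqxx. Qed.

(** If [F :\ j] is outside [D], convexity keeps every [F :\ j :\ l] outside as well, so truncation
    drops only zero terms. *)
Lemma sdiff_trunc D c F : convex D -> supported D c -> F \in D ->
  sdiff (trunc D (sdiff c)) F = 0.
Proof.
move=> cD sc FD; rewrite -[RHS](sdiff_sdiff c F); apply: eq_bigr => j jF.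
rewrite /trunc; case: ifPn => // nD; congr (_ * _); symmetry.
apply: big1 => l; rewrite !inE => /andP[lj lF].
rewrite (supp0 sc) ?mulr0 //; apply: contra nD => h.
by apply: (cD _ _ _ h FD); rewrite subD1set.
Qed.

Lemma acyclic0 : acyclic set0.
Proof.
move=> c sc _; exists (fun=> 0) => F; rewrite ?inE ?eqxx //.
Qed.

(** Cochains on the up-closed part [D1] form a subcomplex with quotient the cochains on [D :\: D1].
    A primitive is found on the quotient first; the remaining error lives on [D1]. *)
Lemma acyclic_split D D1 : convex D -> D1 \subset D ->
  (forall F G, F \in D1 -> G \in D -> F \subset G -> G \in D1) ->
  acyclic D1 -> acyclic (D :\: D1) -> acyclic D.
Proof.
move=> cD sD up a1 a0 c sc dc.
have out F j : F \in D :\: D1 -> j \in F -> F :\ j \notin D1.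
  rewrite inE => /andP[FN FD] jF; apply: contra FN => h.
  exact: (up _ _ h FD (subD1set _ _)).
have d1 b F : supported D1 b -> F \in D :\: D1 -> sdiff b F = 0.
  move=> sb FD; apply: big1 => j jF.
  by rewrite (supp0 sb) ?mulr0 // (out _ _ FD).
have [|F FD|b0 sb0 db0] := a0 (trunc (D :\: D1) c).
- exact: supp_trunc.
- have FD' : F \in D by move: FD; rewrite inE => /andP[].
  rewrite -[RHS](dc F FD'); apply: eq_bigr => j jF; congr (_ * _).
  rewrite /trunc; case: ifPn => //; rewrite inE (out _ _ FD jF) /= => h.
  by rewrite (supp0 sc h).
have sb0' : supported D b0 by move=> F /sb0; rewrite inE => /andP[].
have [F|F F1|b1 sb1 db1] := a1 (fun F => c F - trunc D (sdiff b0) F).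
- apply: contraR => F1; rewrite /trunc; case: ifPn => FD.
    have F0 : F \in D :\: D1 by rewrite inE F1.
    by rewrite db0 // /trunc F0 subrr.
  by rewrite (supp0 sc FD) subrr.
- have FD := subsetP sD _ F1.
  rewrite sdiffD sdiffN dc // sdiff_trunc // subrr //.
have sb1' : supported D b1 by move=> F /sb1 /(subsetP sD).
exists (fun F => b0 F + b1 F).
  move=> F; apply: contraR => FD /=.
  by rewrite (supp0 sb0' FD) (supp0 sb1' FD) addr0.
move=> F FD; rewrite sdiffD; case: (boolP (F \in D1)) => F1.
  by rewrite db1 // /trunc FD addrC subrK.
have F0 : F \in D :\: D1 by rewrite inE F1.
by rewrite (d1 b1) // addr0 db0 // /trunc F0.
Qed.

(** Contraction along [x]: subtracting the coboundary of [b] kills [c] on all sets containing [x],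
    and the cocycle condition then kills the rest. *)
Lemma acyclic_toggle D x : convex D ->
  (forall F, F \in D -> F :\ x \in D) -> (forall F, F \in D -> x |: F \in D) ->
  acyclic D.
Proof.
move=> cD dn up c sc dc.
pose b F := if x \in F then 0 else (-1) ^+ nbelow (x |: F) x * c (x |: F).
have sb : supported D b.
  move=> F; rewrite /b; case: ifPn => xF; rewrite ?eqxx // => h.
  have /sc/dn : c (x |: F) != 0 by apply: contraNneq h => ->; rewrite mulr0.
  by rewrite setU1K.
exists b => // F FD; apply/eqP; rewrite eq_sym -subr_eq0; apply/eqP.
pose e G := c G - trunc D (sdiff b) G.
have eD G : G \in D -> e G = c G - sdiff b G by rewrite /e /trunc => ->.
have eN G : G \notin D -> e G = 0.
  by move=> GD; rewrite /e /trunc (negPf GD) (supp0 sc GD) subrr.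
have de G : G \in D -> sdiff e G = 0.
  by move=> GD; rewrite sdiffD sdiffN dc // sdiff_trunc // subrr.
have ex G : x \in G -> e G = 0.
  move=> xG; case: (boolP (G \in D)) => GD; last exact: eN.
  rewrite eD // /sdiff (bigD1 x) //= big1 ?addr0 => [|j /andP[jG jx]].
    by rewrite /b setD11 setD1K // mulrA -exprD addnn -mul2n exprM sqrrN !expr1n mul1r subrr.
  by rewrite /b !inE xG eq_sym jx mulr0.
rewrite -eD //; case: (boolP (x \in F)) => xF; first exact: ex.
(* At [x |: F] only the term [e F] survives, the others being values of [e] at sets containing
   [x]. *)
have := de _ (up _ FD); rewrite /sdiff (bigD1 x) ?setU11 //= big1 ?addr0.
  rewrite setU1K // => /(congr1 (fun y => (-1) ^+ nbelow (x |: F) x * y)).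
  by rewrite mulrA -exprD addnn -mul2n exprM sqrrN !expr1n mul1r mulr0.
move=> j /andP[_ jx]; rewrite ex ?mulr0 // !inE eqxx eq_sym jx //.
Qed.

(** Induction on [#|Y|]: for [y] in [Y], the members containing [y] are up-closed in [D], so
    [acyclic_split] applies. *)
Lemma acyclic_fibers (Y : {set 'I_n}) D : convex D ->
  (forall F0, acyclic [set F in D | F :&: Y == F0 :&: Y]) -> acyclic D.
Proof.
move: {2}#|Y| (erefl #|Y|) => m; elim: m Y D => [|m IH] Y0 D.
  move=> /cards0_eq -> _ /(_ set0).
  rewrite (_ : [set F in D | _] = D) //.
  by apply/setP => F; rewrite inE !setI0 eqxx andbT.
move=> cY; have /set0Pn[y yY0] : Y0 != set0 by rewrite -cards_eq0 cY.
have [Y yY eY] : exists2 Y : {set 'I_n}, y \notin Y & Y0 = y |: Y.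
  by exists (Y0 :\ y); rewrite ?setD11 // setD1K.
subst Y0; move: cY; rewrite cardsU1 yY add1n => -[cY] {yY0} cD aD.
have eqI (F F0 : {set 'I_n}) : (F :&: (y |: Y) == F0 :&: (y |: Y)) =
    ((y \in F) == (y \in F0)) && (F :&: Y == F0 :&: Y).
  apply/eqP/andP => [/setP e|[/eqP e1 /eqP/setP e2]].
    split; first by have := e y; rewrite !inE eqxx !andbT => ->.
    apply/eqP/setP => z; have := e z; rewrite !inE.
    by case: (z \in Y); rewrite ?andbF // orbT.
  apply/setP => z; have := e2 z; rewrite !inE.
  case: eqP => [-> _|//]; by rewrite e1.
apply: (@acyclic_split _ [set F in D | y \in F]) => //.
- by apply/subsetP => F; rewrite inE => /andP[].
- by move=> F G; rewrite !inE => /andP[_ yF] -> /subsetP/(_ _ yF).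
- apply: (IH Y) => // [F G H|F0]; rewrite ?inE.
    move=> /andP[FD yF] /andP[HD yH] FG GH.
    by rewrite (cD _ _ _ FD HD FG GH) (subsetP FG).
  have := aD (y |: F0); congr acyclic; apply/setP => F; rewrite !inE eqI !inE eqxx /=.
  rewrite -andbA; congr [&& _, _ & _]; first by case: (y \in F).
  by rewrite setIUl (_ : [set y] :&: Y = set0) ?set0U //; apply/disjoint_setI0; rewrite disjoints1.
- apply: (IH Y) => // [F G H|F0]; rewrite ?inE.
    move=> /andP[h FD] /andP[h' HD] FG GH.
    rewrite (cD _ _ _ FD HD FG GH) andbT /=.
    by apply: contra h' => /(subsetP GH) ->; rewrite HD.
  have := aD (F0 :\ y); congr acyclic; apply/setP => F; rewrite !inE eqI !inE eqxx /=.
  case: (F \in D) => //=; case: (y \in F) => //=.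
  by rewrite setIDAC (setDidPl _) // disjoint_sym disjoints1 inE (negPf yY) andbF.
Qed.

End SetCochains.

(** * Cohomology of up-closed families, by degree *)

Section UpClosed.
Variables (n : nat) (V : nzRingType) (D : {set {set 'I_n}}).
Hypothesis upD : forall F G : {set 'I_n}, F \in D -> F \subset G -> G \in D.
Implicit Types (c b : {set 'I_n} -> V).

Lemma up_convex : convex D.
Proof. by move=> F G H FD _ FG _; apply: upD FG. Qed.

(** For up-closed [D] the differential preserves supports. Writing the degree of [b] as
    [#|F|.+1 = i] forces [b = 0] when [i = 0]. *)
Definition coh_neq0 (i : nat) : Prop := exists c,
  [/\ supported D c, forall F, c F != 0 -> #|F| = i, forall F, sdiff c F = 0
    & ~ exists b, [/\ supported D b, forall F, b F != 0 -> #|F|.+1 = i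
                    & forall F, sdiff b F = c F]].

(** As [acyclic] ignores degrees, a primitive is cut down to sets of size [i - 1]; this is harmless
    since [sdiff] raises the size by one. *)
Lemma sdiff_deg c b (i : nat) : (forall F, c F != 0 -> #|F| = i) ->
  (forall F, F \in D -> sdiff b F = c F) -> supported D b -> supported D c ->
  exists b' : {set 'I_n} -> V, [/\ forall F, b' F != 0 -> b F != 0,
    forall F, b' F != 0 -> #|F|.+1 = i & forall F, sdiff b' F = c F].
Proof.
move=> ci db sb sc; exists (fun F : {set 'I_n} => if #|F|.+1 == i then b F else 0); split.
- by move=> F; case: ifP => //; rewrite eqxx.
- by move=> F; case: (#|F|.+1 =P i) => //; rewrite eqxx.
move=> F; case: (boolP (F \in D)) => [FD|FD]; last first.
  rewrite (supp0 sc) //; apply: big1 => j jF.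
  suff -> : b (F :\ j) = 0 by rewrite if_same mulr0.
  by apply: (supp0 sb); apply: contra FD => h; apply: upD h (subD1set _ _).
case: (eqVneq #|F| i) => [Fi|Fi].
  rewrite -db //; apply: eq_bigr => j jF.
  by rewrite -Fi (cardsD1 j F) jF add1n eqxx.
transitivity (0 : V).
  apply: big1 => j jF; move: Fi; rewrite (cardsD1 j F) jF add1n => /negPf ->.
  by rewrite mulr0.
by apply/esym/eqP; apply: contraR Fi => /ci ->.
Qed.

Lemma coh_neq0_acyclic i : coh_neq0 i -> ~ acyclic V D.
Proof.
case=> c [sc ci dc nb] /(_ c sc) [F _|b sb db]; first exact: dc.
have [b' [bb b'i db']] := sdiff_deg ci db sb sc.
by apply: nb; exists b'; split=> // F /bb /sb.
Qed.

Lemma coh_neq0_supp i : coh_neq0 i -> exists2 F, F \in D & #|F| = i.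
Proof.
case=> c [sc ci dc nb].
case: (pickP (fun F => c F != 0)) => [F cF|c0]; first by exists F; [exact: sc | exact: ci].
case: nb; exists (fun=> 0); split=> [F|F|F]; rewrite ?eqxx //.
have /eqP-> : c F == 0 by apply: negbFE; exact: c0.
by apply: big1 => j _; rewrite mulr0.
Qed.

(** The coboundary of the indicator [c0] of [F0] lives on [D :\ F0], hence is that of some [b]
    supported there. The cocycle [c0 - b] is 1 at [F0], where every coboundary vanishes by
    minimality. *)
Lemma coh_neq0_min F0 : F0 \in D -> (forall j, j \in F0 -> F0 :\ j \notin D) ->
  acyclic V (D :\ F0) -> coh_neq0 #|F0|.
Proof.
move=> F0D minF0 ac.
have d0 b : supported D b -> sdiff b F0 = 0.
  move=> sb; apply: big1 => j jF; by rewrite (supp0 sb (minF0 _ jF)) mulr0.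
pose c0 F : V := (F == F0)%:R.
have sc0 : supported D c0 by move=> F; rewrite /c0; case: (eqVneq F F0) => [-> //|]; rewrite eqxx.
have cc0 F : sdiff c0 F != 0 -> #|F| = #|F0|.+1.
  move=> /eqP h; have [//|/eqP Fc] := eqVneq #|F| #|F0|.+1; case: h.
  apply: big1 => j jF; rewrite /c0; case: eqP => [e|]; last by rewrite mulr0.
  by case: Fc; rewrite (cardsD1 j) jF e.
have sd : supported (D :\ F0) (sdiff c0).
  move=> F h; rewrite !inE; apply/andP; split.
    by apply: contraNneq h => ->; rewrite d0.
  apply: contraR h => FD; rewrite /sdiff big1 // => j jF.
  rewrite (supp0 sc0) ?mulr0 //; apply: contra FD => h; exact: upD h (subD1set _ _).
have [F _|b1 sb1 db1] := ac _ sd; first exact: sdiff_sdiff.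
have sb1' : supported D b1 by move=> F /sb1; rewrite inE => /andP[].
have sd' : supported D (sdiff c0) by move=> F /sd; rewrite inE => /andP[].
have [|b [sb bc db]] := @sdiff_deg (sdiff c0) b1 _ cc0 _ sb1' sd'.
  move=> F FD; have [->|h] := eqVneq F F0; first by rewrite !d0.
  by rewrite db1 // !inE h.
have b0 : b F0 = 0.
  by apply/eqP; apply/negPn/negP => /sb /sb1; rewrite !inE eqxx.
exists (fun F => c0 F - b F); split.
- move=> F; apply: contraR => FD.
  rewrite (supp0 sc0 FD) sub0r (_ : b F = 0) ?oppr0 //.
  by apply/eqP; apply: contraR FD => /sb/sb1'.
- move=> F; have [->//|FF0] := eqVneq F F0.
  rewrite /c0 (negPf FF0) sub0r oppr_eq0 => /bc []//.
- by move=> F; rewrite sdiffD sdiffN db subrr.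
case=> b2 [sb2 _ /(_ F0)]; rewrite d0 // /c0 eqxx b0 subr0 => /eqP.
by rewrite eq_sym oner_eq0.
Qed.

End UpClosed.

(** * The family of sets attached to a multidegree *)

Section DegreeFamilies.
Variables (n : nat) (E : rel 'I_n).
Implicit Types (a : 'I_n -> int) (s : nat) (F G : {set 'I_n}).

(* The sets [F] for which the multidegree [a] component of [(J^s)_{x_F}] is
   nonzero. *)
Definition covfam s a : {set {set 'I_n}} :=
  locked [set F : {set 'I_n} | [forall j, (a j < 0) ==> (j \in F)] &&
    [forall i, forall j, [&& E i j, i \notin F & j \notin F] ==> (s%:Z <= a i + a j)]].

Lemma covfamP s a F :
  reflect ((forall j, a j < 0 -> j \in F) /\
    (forall i j, E i j -> i \notin F -> j \notin F -> s%:Z <= a i + a j))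
  (F \in covfam s a).
Proof.
rewrite /covfam -lock inE; apply: (iffP andP) => -[h1 h2]; split.
- by move=> j; move/forallP/(_ j)/implyP: h1.
- move=> i j e iF jF; move/forallP/(_ i)/forallP/(_ j)/implyP: h2; apply.
  by rewrite e iF.
- by apply/forallP => j; apply/implyP/h1.
- apply/forallP => i; apply/forallP => j; apply/implyP => /and3P[*]; exact: h2.
Qed.

Lemma covfam_up s a F G : F \in covfam s a -> F \subset G -> G \in covfam s a.
Proof.
move=> /covfamP[h1 h2] /subsetP FG; apply/covfamP; split=> [j /h1/FG //|i j e iG jG].
by apply: h2 => //; [apply: contra iG|apply: contra jG]; exact: FG.
Qed.

Lemma eq_covfam s a a' : a =1 a' -> covfam s a = covfam s a'.
Proof.
move=> e; apply/setP => F; apply/covfamP/covfamP => -[h1 h2]; split.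
- by move=> j; rewrite -e; apply: h1.
- by move=> i j; rewrite -!e; apply: h2.
- by move=> j; rewrite e; apply: h1.
- by move=> i j; rewrite !e; apply: h2.
Qed.

Variable V : nzRingType.

Lemma covfam_convex s a : convex (covfam s a).
Proof. by apply: up_convex; exact: covfam_up. Qed.

Hypothesis E_simple : simple_graph E.

Let Esym i j : E i j -> E j i. Proof. by case: E_simple => sE _; rewrite sE. Qed.
Let Eirr i j : E i j -> i != j.
Proof. by case: E_simple => _ iE; apply: contraTneq => ->; rewrite iE. Qed.

(** Otherwise removing [w] from a member never breaks an edge condition, and [w] can be toggled
    freely. *)
Lemma covfam_neighbor s a w : ~ acyclic V (covfam s a) -> 0 <= a w ->
  exists w', [/\ E w w', 0 <= a w' & a w + a w' < s%:Z].
Proof.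
move=> nac aw.
case: (pickP (fun w' => [&& E w w', 0 <= a w' & a w + a w' < s%:Z])) => [w' /and3P h|h].
  by exists w'.
case: nac; apply: (@acyclic_toggle _ _ _ w); first exact: covfam_convex.
  move=> F /covfamP[h1 h2]; apply/covfamP.
  have hw j : j \notin F :\ w -> E w j -> s%:Z <= a w + a j.
    move=> jF e; rewrite leNgt; apply: contraFN (h j) => ->.
    rewrite e andbT /= leNgt; apply: contra jF => /h1 jF.
    by rewrite !inE eq_sym Eirr.
  split=> [j aj|i j e].
    rewrite !inE h1 // andbT; apply: contraTneq aj => ->; by rewrite -leNgt.
  have [iw|iw] := eqVneq i w; first by move=> _ jF; rewrite iw hw // -iw.
  have [jw|jw] := eqVneq j w.
    by move=> iF _; rewrite jw addrC hw //; apply: Esym; rewrite -jw.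
  by rewrite !inE iw jw /=; apply: h2.
by move=> F FD; apply: covfam_up FD (subsetUr _ _).
Qed.

(* Decide, for every vertex of [Y], whether it belongs to [F]: some fibre is not
   acyclic, and no vertex [x] of [X] can be toggled freely in it, so that [x]
   has a neighbour in the set [Z] of those vertices of [Y] left out. *)
Lemma covfam_minimal_cover s a (X : {set 'I_n}) : ~ acyclic V (covfam s a) ->
  (forall x, x \in X -> 0 <= a x) ->
  (forall x x', E x x' -> x \in X -> x' \in X -> s%:Z <= a x + a x') ->
  (forall y y', E y y' -> 0 <= a y -> 0 <= a y' -> y \notin X -> y' \notin X ->
     a y + a y' < s%:Z) ->
  exists2 C, minimal_vertex_cover E C & X \subset C.
Proof.
move=> nac X0 XB YC.
pose Y := [set y | (0 <= a y) && (y \notin X)].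
have YXd x : x \in X -> x \notin Y by move=> xX; rewrite !inE xX andbF.
(* Either some member leaves out a neighbour in [Y] of each [x] in [X], or every nonempty fibre over
   [Y] has a vertex of [X] that toggles. *)
case: (pickP (fun F0 : {set 'I_n} => (F0 \in covfam s a) &&
    [forall x in X, exists z, [&& z \in Y, z \notin F0 & E x z]])) => [F0|h]; last first.
  case: nac; apply: (@acyclic_fibers _ _ Y); first exact: covfam_convex.
  move=> F1; set D' := (X in acyclic _ X).
  have cD' : convex D'.
    move=> F G H; rewrite !inE => /andP[FD /eqP F1Y] /andP[HD /eqP H1Y] FG GH.
    rewrite (covfam_convex FD HD FG GH) eqEsubset /=; apply/andP; split.
      by rewrite -H1Y setSI.
    by rewrite -F1Y setSI.
  have [->|[F0]] := set_0Vmem D'; first exact: acyclic0.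
  rewrite inE => /andP[F0D /eqP F01].
  move: (h F0); rewrite F0D /= => /negbT; rewrite negb_forall => /existsP[x].
  rewrite negb_imply negb_exists => /andP[xX /forallP nx].
  apply: (@acyclic_toggle _ _ _ x) => // F; rewrite !inE => /andP[FD /eqP FY].
    have eY : (F :\ x) :&: Y = F :&: Y.
      rewrite setIDAC; apply/setDidPl; rewrite disjoint_sym disjoints1 inE.
      by rewrite (negPf (YXd _ xX)) andbF.
    rewrite eY FY eqxx andbT; have /covfamP[h1 h2] := FD.
    have hw j : j \notin F :\ x -> E x j -> s%:Z <= a x + a j.
      move=> jF e.
      have jx : j != x by rewrite eq_sym Eirr.
      have jF' : j \notin F by move: jF; rewrite !inE jx.
      have aj : 0 <= a j by rewrite leNgt; apply: contra jF' => /h1.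
      have [jX|jX] := boolP (j \in X); first exact: XB.
      have jY : j \in Y by rewrite inE aj.
      have jF0 : j \notin F0.
        have : j \notin F :&: Y by rewrite inE (negPf jF').
        by rewrite FY -F01 inE jY andbT.
      by move: (nx j); rewrite jY jF0 e.
    apply/covfamP; split=> [j aj|i j e].
      rewrite !inE h1 // andbT; apply: contraTneq aj => ->.
      by rewrite -leNgt X0.
    have [iw|iw] := eqVneq i x; first by move=> _ jF; rewrite iw hw // -iw.
    have [jw|jw] := eqVneq j x.
      by move=> iF _; rewrite jw addrC hw //; apply: Esym; rewrite -jw.
    by rewrite !inE iw jw /=; apply: h2.
  rewrite (covfam_up FD (subsetUr _ _)) setIUl.
  have -> : [set x] :&: Y = set0.
    by apply/disjoint_setI0; rewrite disjoints1 YXd.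
  by rewrite set0U FY eqxx.
move=> /andP[F0D /forallP nx]; have /covfamP[h1 h2] := F0D.
(* [Z] is independent: an edge inside would have sum at least [s] by membership of [F0], and below
   [s] by [YC]. A minimal cover avoiding [Z] must contain all neighbours of [Z], hence [X]. *)
pose Z := Y :\: F0.
have cZ : vertex_cover E (~: Z).
  apply/forallP => i; apply/forallP => j; apply/implyP => e.
  rewrite !in_setC -negb_and; apply/andP => -[iZ jZ].
  move: iZ jZ; rewrite !inE => /and3P[iF ai iX] /and3P[jF aj jX].
  by have := h2 _ _ e iF jF; rewrite leNgt YC.
have [C mC CZ] := minset_exists cZ; exists C => //.
apply/subsetP => x xX; move/implyP: (nx x) => /(_ xX)/existsP[z /and3P[zY zF e]].
have zC : z \notin C.
  by apply: contraT => /negbNE/(subsetP CZ); rewrite !inE in zY *; rewrite zY zF.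
have /forallP/(_ x)/forallP/(_ z)/implyP/(_ e) := minsetp mC.
by rewrite (negPf zC) orbF.
Qed.

End DegreeFamilies.

(** * Threshold sets and the growth of the maximal degree *)

Lemma sum_ltn_ord (m p : nat) : (m <= p)%N -> (\sum_(t < p) (t < m))%N = m.
Proof.
move=> mp; rewrite -{2}(minn_idPl mp) {mp}.
by elim: p => [|p IH]; [rewrite big_ord0 minn0|rewrite big_ord_recr /= IH; lia].
Qed.

Lemma sum_geq_ord (k p : nat) : (\sum_(t < p) (k <= t))%N = (p - k)%N.
Proof.
by elim: p => [|p IH]; [rewrite big_ord0|rewrite big_ord_recr /= IH; lia].
Qed.

Lemma card_set_sum (T : finType) (X : {set T}) : #|X| = (\sum_j (j \in X))%N.
Proof. by rewrite -sum1_card big_mkcond; apply: eq_bigr => j _; case: ifP. Qed.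

Section Regularity.
Variables (n : nat) (E : rel 'I_n) (V : nzRingType) (A : {set 'I_n}).
Hypothesis E_simple : simple_graph E.
Hypothesis EA : forall i j, E i j -> (i \in A) != (j \in A).
Implicit Types (a : 'I_n -> int) (s p : nat) (F G : {set 'I_n}).

Let Esym i j : E i j -> E j i. Proof. by case: E_simple => sE _; rewrite sE. Qed.

Definition max_cover : nat := \max_(C : {set 'I_n} | minimal_vertex_cover E C) #|C|.

(** Here [p] stands for [s - 1]. An edge inside has sum at least [p + 1]; an edge between
    nonnegative entries outside has sum at most [p - 1]. *)
Definition threshold p a (t : nat) : {set 'I_n} :=
  [set j | (0 <= a j) && (if j \in A then t%:Z < a j else p%:Z <= a j + t%:Z)].

Lemma threshold_le_cover p a t : ~ acyclic V (covfam E p.+1 a) ->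
  (#|threshold p a t| <= max_cover)%N.
Proof.
move=> nac.
have [|x x' e|y y' e ay ay'|C mC sC] := @covfam_minimal_cover n E V E_simple p.+1 a (threshold p a t) nac.
- by move=> x; rewrite inE => /andP[].
- by move: (EA e); rewrite !inE; case: (x \in A); case: (x' \in A) => //= _; lia.
- by move: (EA e); rewrite !inE; case: (y \in A); case: (y' \in A) => //= _; lia.
by apply: leq_trans (subset_leq_card sC) _; exact: leq_bigmax_cond.
Qed.

Lemma sum_threshold p a : ~ acyclic V (covfam E p.+1 a) ->
  \sum_(j | 0 <= a j) a j = (\sum_(t < p) #|threshold p a t|)%N%:Z.
Proof.
move=> nac.
have -> : (\sum_(t < p) #|threshold p a t| = \sum_(j | (0 <= a j)%R) absz (a j))%N.
  rewrite (eq_bigr (fun t : 'I_p => \sum_j (j \in threshold p a t))%N); last first.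
    by move=> t _; exact: card_set_sum.
  rewrite exchange_big /= [RHS]big_mkcond; apply: eq_bigr => j _.
  case: (boolP (0 <= a j)) => aj; last first.
    by apply: big1 => t _; rewrite inE (negPf aj).
  (* The neighbour bounds [a j] by [p], so [j] lies in exactly [a j] of the [p] threshold sets: the
     first ones if [j] is in [A], the last ones otherwise. *)
  have [w [_ aw jw]] := covfam_neighbor E_simple nac aj.
  have aE : a j = absz (a j) by lia.
  have ap : (absz (a j) <= p)%N by lia.
  case: (boolP (j \in A)) => jA.
    rewrite -[RHS](sum_ltn_ord ap); apply: eq_bigr => t _.
    by rewrite inE aj jA /=; congr nat_of_bool; lia.
  have -> : absz (a j) = (p - (p - absz (a j)))%N by rewrite subKn.
  rewrite -sum_geq_ord; apply: eq_bigr => t _.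
  by rewrite inE aj (negPf jA) /=; congr nat_of_bool; lia.
by rewrite (big_morph _ PoszD (erefl 0%:Z)); apply: eq_bigr => j; lia.
Qed.

(** Negative entries only lower the sum, and [i], the size of a member, is at most [n]. *)
Lemma degree_le p a i (q : nat) : coh_neq0 V (covfam E p.+1 a) i ->
  (forall t, (t < p)%N -> (#|threshold p a t| <= q)%N) ->
  \sum_j a j + i%:Z <= (p * q + n)%N%:Z.
Proof.
move=> ci tq.
have [F _ Fi] := coh_neq0_supp ci.
have i_n : (i <= n)%N by rewrite -Fi -[leqRHS](card_ord n) max_card.
have nac := coh_neq0_acyclic (@covfam_up _ E p.+1 a) ci.
rewrite (bigID (fun j => 0 <= a j)) /= (sum_threshold nac).
have : \sum_(j | ~~ (0 <= a j)) a j <= 0.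
  by apply: sumr_le0 => j; lia.
have : (\sum_(t < p) #|threshold p a t| <= p * q)%N.
  apply: (@leq_trans (\sum_(t < p) q)); last by rewrite sum_nat_const card_ord.
  by apply: leq_sum => t _; exact: tq.
move: (\sum_(j | _) _) (\sum_(t < p) _)%N i_n => x y; lia.
Qed.

(** A vertex left out of a member has a nonnegative entry, so only the edge inequalities between
    such entries matter. *)
Lemma eq_covfam_edges s s' a a' : (forall j, (a j < 0) = (a' j < 0)) ->
  (forall i j, i \in A -> j \notin A -> 0 <= a i -> 0 <= a j ->
     (s%:Z <= a i + a j) = (s'%:Z <= a' i + a' j)) ->
  covfam E s a = covfam E s' a'.
Proof.
move=> e0 e1.
have e2 i j : E i j -> 0 <= a i -> 0 <= a j ->
    (s%:Z <= a i + a j) = (s'%:Z <= a' i + a' j).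
  move=> /EA; case: (boolP (i \in A)) => iA; case: (boolP (j \in A)) => jA // _ ai aj.
    exact: e1.
  by rewrite addrC [in RHS]addrC e1.
apply/setP => F; apply/covfamP/covfamP => -[h1 h2]; split.
- by move=> j; rewrite -e0; apply: h1.
- move=> i j e iF jF; rewrite -e2 //; first exact: h2.
  + by rewrite leNgt; apply: contra iF; apply: h1.
  + by rewrite leNgt; apply: contra jF; apply: h1.
- by move=> j; rewrite e0; apply: h1.
- move=> i j e iF jF; rewrite e2 //; first exact: h2.
  + by rewrite leNgt e0; apply: contra iF; apply: h1.
  + by rewrite leNgt e0; apply: contra jF; apply: h1.
Qed.

(** With both ends in the threshold set the inequality holds before and after, with none it fails
    before and after, and with one both sides grow by 1. *)
Lemma covfam_stretch p a t :
  covfam E p.+2 (fun j => a j + (j \in threshold p a t)%:Z) = covfam E p.+1 a.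
Proof.
apply/esym/eq_covfam_edges => [j|i j iA jA ai aj]; rewrite !inE; first by lia.
by rewrite ai aj iA (negPf jA) /=; lia.
Qed.

(** Since [t <= p], the entries lowered are positive, so signs persist. Since [t + 1] is not a value
    of [a], an edge inside has sum at least [p + 3] and can afford to lose 2. *)
Lemma covfam_shrink p a t : (t <= p)%N -> (forall j, a j != t.+1%:Z) ->
  covfam E p.+1 (fun j => a j - (j \in threshold p.+1 a t)%:Z) = covfam E p.+2 a.
Proof.
move=> tp ht; apply/esym/eq_covfam_edges => [j|i j iA jA ai aj]; rewrite !inE.
  by case: (j \in A); lia.
by have := ht i; rewrite ai aj iA (negPf jA) /=; lia.
Qed.

Definition reg_value s (v : int) : Prop :=
  exists a i, coh_neq0 V (covfam E s a) i /\ v = \sum_j a j + i%:Z.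

Lemma reg_value_le p v : reg_value p.+1 v -> v <= (p * max_cover + n)%N%:Z.
Proof.
case=> a [i [ci ->]]; apply: (degree_le ci) => t _; apply: threshold_le_cover => ac.
by have := coh_neq0_acyclic (@covfam_up _ E p.+1 a) ci.
Qed.

Lemma sum_indicator (X : {set 'I_n}) : \sum_j (j \in X)%:Z = #|X|%:Z.
Proof.
by rewrite card_set_sum (big_morph _ PoszD (erefl 0%:Z)).
Qed.

(** If no threshold set had [max_cover] elements, [degree_le] would bound [v] by
    [p * (max_cover - 1) + n], which is below [max_cover * p.+1] because [n < p]. *)
Lemma reg_value_up p v : (n < p)%N -> (max_cover * p.+1)%N%:Z <= v ->
  reg_value p.+1 v -> reg_value p.+2 (v + max_cover%:Z).
Proof.
move=> np hv [a [i [ci ev]]].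
have nac := coh_neq0_acyclic (@covfam_up _ E p.+1 a) ci.
case: (pickP (fun t : 'I_p => #|threshold p a t| == max_cover)) => [t /eqP tm|h].
  exists (fun j => a j + (j \in threshold p a t)%:Z), i; rewrite covfam_stretch; split=> //.
  by rewrite big_split /= sum_indicator tm ev addrAC.
have tq t : (t < p)%N -> (#|threshold p a t| <= max_cover.-1)%N.
  move=> tp; have /= ht := h (Ordinal tp).
  by have := threshold_le_cover t nac; rewrite leq_eqVlt ht /=; case: max_cover.
have := degree_le ci tq.
(* This makes [max_cover.-1] a true predecessor. *)
have : (0 < max_cover)%N.
  have p0 : (0 < p)%N by lia.
  have /= h0 := h (Ordinal p0).
  by have := threshold_le_cover 0 nac; rewrite leq_eqVlt h0 /=; case: max_cover.
move: hv; rewrite -ev; nia.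
Qed.

(** By pigeonhole the [n] entries of [a] miss one of the [p + 1] values [1, ..., p + 1]; shrinking
    there costs at most [max_cover]. *)
Lemma reg_value_down p v : (n <= p)%N -> reg_value p.+2 v ->
  exists2 v', reg_value p.+1 v' & v <= v' + max_cover%:Z.
Proof.
move=> np [a [i [ci ev]]].
have nac := coh_neq0_acyclic (@covfam_up _ E p.+2 a) ci.
have [t ht] : exists t : 'I_p.+1, forall j, a j != t.+1%:Z.
  case: (pickP (fun t : 'I_p.+1 => [forall j, a j != t.+1%:Z])) => [t /forallP ht|h].
    by exists t.
  have /fin_all_exists[f hf] (t : 'I_p.+1) : exists j, a j = t.+1%:Z.
    by move/negbT: (h t); rewrite negb_forall => /existsP[j]; rewrite negbK => /eqP; exists j.
  have fI : injective f.
    by move=> t t' e; apply: val_inj => /=; have := hf t; rewrite e hf; lia.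
  by have := leq_card f fI; rewrite !card_ord; lia.
have tp : (t <= p)%N by rewrite -ltnS.
exists (\sum_j (a j - (j \in threshold p.+1 a t)%:Z) + i%:Z).
  by exists (fun j => a j - (j \in threshold p.+1 a t)%:Z), i; rewrite covfam_shrink.
rewrite ev sumrB sum_indicator.
have := threshold_le_cover t nac.
by move: (\sum_j a j) #|_| => x y; lia.
Qed.

(* Let [Z] be a minimal set outside a minimal cover [C] of maximal size that
   dominates [C]; take [a = s - 1] on [C], [0] on [Z] and [-1] elsewhere.  The
   part of the family meeting [Z] is acyclic, and only [~: Z] remains. *)
Lemma reg_value_cover p : reg_value p.+2 (max_cover * p.+2)%N%:Z.
Proof.
have [C mC cC] : exists2 C, minimal_vertex_cover E C & #|C| = max_cover.
  have [C0 mC0 _] : {C | minimal_vertex_cover E C & C \subset [set: 'I_n]}.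
    apply: minset_exists; apply/forallP => i; apply/forallP => j.
    by rewrite !inE implybT.
  rewrite /max_cover.
  have [|C mC ->] := @eq_bigmax_cond {set 'I_n} (minimal_vertex_cover E) (fun C => #|C|).
    by apply/card_gt0P; exists C0.
  by exists C.
have cov i j : E i j -> (i \in C) || (j \in C).
  by have /forallP/(_ i)/forallP/(_ j)/implyP := minsetp mC.
pose dom (Z : {set 'I_n}) := (Z \subset ~: C) && [forall d in C, exists z in Z, E d z].
(* By minimality of [C], each [d] in [C] has a neighbour outside [C]. *)
have domC : dom (~: C).
  rewrite /dom subxx; apply/forallP => d; apply/implyP => dC.
  apply: contraT; rewrite negb_exists => /forallP h.
  have /(minsetinf mC)/(_ (subD1set _ _))/setP/(_ d) : vertex_cover E (C :\ d).
    apply/forallP => i; apply/forallP => j; apply/implyP => e.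
    have ij : i != j by case: E_simple => _ iE; apply: contraTneq e => ->; rewrite iE.
    have [ed|ni] := eqVneq i d.
      have := h j; rewrite -ed !inE e andbT => /negbNE ->.
      by rewrite andbT (eq_sym j) ij orbT.
    have [ed|nj] := eqVneq j d.
      by have := h i; rewrite !inE -ed (Esym e) andbT ij => /negbNE ->.
    by rewrite !inE ni nj; apply: cov.
  by rewrite !inE eqxx dC.
have [Z mZ _] := minset_exists domC.
have /andP[ZC /forallP dZ] := minsetp mZ.
pose a j : int := if j \in C then p.+1%:Z else if j \in Z then 0 else -1.
have aC j : j \in C -> a j = p.+1%:Z by rewrite /a => ->.
have aZ j : j \in Z -> a j = 0.
  by move=> jZ; rewrite /a jZ; move/subsetP: ZC => /(_ j jZ); rewrite inE => /negPf ->.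
have aN j : j \notin C -> j \notin Z -> a j = -1.
  by rewrite /a => /negPf -> /negPf ->.
pose F0 := ~: Z.
have F0D : F0 \in covfam E p.+2 a.
  apply/covfamP; split=> [j|i j e]; first by rewrite inE; apply: contraTN => /aZ ->.
  rewrite !inE !negbK => /(subsetP ZC) iC /(subsetP ZC) jC.
  by have := cov _ _ e; rewrite !inE in iC jC; rewrite (negPf iC) (negPf jC).
have inF F j : F \in covfam E p.+2 a -> j \notin F -> (j \in C) || (j \in Z).
  move=> /covfamP[h1 _]; apply: contraR; rewrite negb_or => /andP[jC jZ].
  by apply: h1; rewrite aN.
(* A vertex of [C] left out would have a neighbour in [Z] also left out, with edge sum only
   [p + 1]. *)
have minF F : F \in covfam E p.+2 a -> F :&: Z = set0 -> F = F0.
  move=> FD FZ; have FZ' j : j \in Z -> j \notin F.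
    by move=> jZ; apply/negP => jF; move/setP/(_ j): FZ; rewrite !inE jF jZ.
  apply/setP => j; rewrite inE; have [jZ|jZ] := boolP (j \in Z).
    by apply/negbTE/FZ'.
  apply: contraT => jF; have := inF _ _ FD jF; rewrite (negPf jZ) orbF => jC.
  have /implyP/(_ jC)/existsP[z /andP[zZ e]] := dZ j.
  have /covfamP[_ /(_ _ _ e jF (FZ' _ zZ))] := FD.
  by rewrite aC // aZ //; lia.
(* Each vertex of [C] contributes [p + 1] and 1; off [C] and [Z], the entry -1 cancels against the
   count in [F0]. *)
have vE : (max_cover * p.+2)%N%:Z = \sum_j a j + #|F0|%:Z.
  have := sum_indicator C; have := sum_indicator F0; rewrite cC => <- e.
  rewrite -big_split /= PoszM -e mulr_suml; apply: eq_bigr => j _.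
  rewrite inE /a; case: (boolP (j \in C)) => jC.
    by have -> : j \in Z = false; [apply: contraTF jC => /(subsetP ZC); rewrite inE|lia].
  by case: (j \in Z).
exists a, #|F0|; split=> //; apply: coh_neq0_min => //.
- by move=> F G; exact: covfam_up.
- move=> j jF0; apply/negP => jD.
  have : F0 :\ j = F0.
    apply: minF => //; apply/setP => k; rewrite !inE.
    by case: (k \in Z); rewrite ?andbF.
  by move/setP/(_ j); rewrite !inE eqxx; move: jF0; rewrite inE => ->.
apply: (@acyclic_fibers _ _ Z).
  move=> F G H; rewrite !in_setD1 => /andP[FF0 FD] /andP[HF0 HD] FG GH.
  rewrite (covfam_convex FD HD FG GH) andbT; apply: contra FF0 => /eqP eG.
  apply/eqP/minF => //; apply/setP => k; rewrite !inE.
  apply/negP => /andP[/(subsetP FG)]; by rewrite eG inE => /negPf ->.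
move=> F1; set D' := (X in acyclic _ X).
have [F1Z|F1Z] := eqVneq (F1 :&: Z) set0.
  have -> : D' = set0; last exact: acyclic0.
  apply/setP => F; rewrite inE in_setD1 in_set0 F1Z; apply/negP => /andP[/andP[FF0 FD] /eqP FZ].
  by rewrite (minF _ FD FZ) eqxx in FF0.
(* Minimality of [Z] yields a vertex [d] of [C] no longer dominated by [Z :\: F1]; it can be toggled
   in this fibre. *)
have [d dC hd] : exists2 d, d \in C & forall z, z \in Z -> E d z -> z \in F1.
  have : ~~ dom (Z :\: F1).
    apply: contra F1Z => /(minsetinf mZ)/(_ (subsetDl _ _)) e.
    by rewrite setIC; apply/eqP/disjoint_setI0/setDidPl.
  rewrite /dom (subset_trans (subsetDl _ _) ZC) /= negb_forall => /existsP[d].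
  rewrite negb_imply negb_exists => /andP[dC /forallP h]; exists d => // z zZ e.
  by have := h z; rewrite inE zZ e !andbT negbK.
have dZ' : d \notin Z by apply: contraTN dC => /(subsetP ZC); rewrite inE.
have nF0 F : F :&: Z = F1 :&: Z -> F != F0.
  by move=> FZ; apply: contraNneq F1Z => e; rewrite -FZ e setIC setICr.
have d'E F : (F \in D') = (F \in covfam E p.+2 a) && (F :&: Z == F1 :&: Z).
  rewrite inE in_setD1; case: (F :&: Z =P F1 :&: Z) => [FZ|]; rewrite ?andbF // !andbT.
  by rewrite nF0.
apply: (@acyclic_toggle _ _ _ d) => [F G H|F|F]; rewrite !d'E.
- move=> /andP[FD /eqP F1Y] /andP[HD /eqP H1Y] FG GH.
  rewrite (covfam_convex FD HD FG GH) eqEsubset /=; apply/andP; split.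
    by rewrite -H1Y setSI.
  by rewrite -F1Y setSI.
- move=> /andP[FD /eqP FZ]; have /covfamP[h1 h2] := FD.
  have -> : (F :\ d) :&: Z = F :&: Z.
    rewrite setIDAC; apply/setDidPl; rewrite disjoint_sym disjoints1 inE.
    by rewrite (negPf dZ') andbF.
  rewrite FZ eqxx andbT.
  have hw j : j \notin F :\ d -> E d j -> p.+2%:Z <= a d + a j.
    move=> jF e; have jd : j != d.
      by case: E_simple => _ iE; apply: contraTneq e => ->; rewrite iE.
    have jF' : j \notin F by move: jF; rewrite !inE jd.
    (* For two vertices of [C] the sum is [2 * (s - 1)], which is at least [s] because
       [s = p + 2]. *)
    rewrite aC //; have [/aC ->|jC] := boolP (j \in C); first by lia.
    have jZ : j \in Z by have := inF _ _ FD jF'; rewrite (negPf jC).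
    have : j \notin F :&: Z by rewrite inE (negPf jF').
    by rewrite FZ inE jZ (hd _ jZ e).
  apply/covfamP; split=> [j aj|i j e].
    by rewrite !inE h1 // andbT; apply: contraTneq aj => ->; rewrite aC.
  have [iw|iw] := eqVneq i d; first by move=> _ jF; rewrite iw hw // -iw.
  have [jw|jw] := eqVneq j d.
    by move=> iF _; rewrite jw addrC hw //; apply: Esym; rewrite -jw.
  by rewrite !inE iw jw /=; apply: h2.
move=> /andP[FD /eqP FZ]; rewrite (covfam_up FD (subsetUr _ _)) setIUl.
have -> : [set d] :&: Z = set0 by apply/disjoint_setI0; rewrite disjoints1.
by rewrite set0U FZ eqxx.
Qed.

End Regularity.

(** * Monomials in the powers of the cover ideal *)

Section CoverPowers.
Variables (K : fieldType) (n : nat) (E : rel 'I_n).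
Local Notation R := {mpoly K[n]}.
Implicit Types (f g : R) (m : 'X_{1..n}) (F C : {set 'I_n}).

Definition mnm_of F : 'X_{1..n} := [multinom (i \in F : nat) | i < n].

Lemma monomE F : monom K F = 'X_[mnm_of F].
Proof.
rewrite mpolyXE_id /monom big_mkcond; apply: eq_bigr => i _.
by rewrite mnmE; case: (i \in F).
Qed.

Definition edge_ge s m := forall i j, E i j -> (s <= m i + m j)%N.

Definition supp_in (S : 'X_{1..n} -> Prop) f := forall m, m \in msupp f -> S m.

Lemma supp_inD S f g : supp_in S f -> supp_in S g -> supp_in S (f + g).
Proof.
by move=> hf hg m /msuppD_le; rewrite mem_cat => /orP[/hf|/hg].
Qed.

Lemma supp_in_sum S (I : eqType) (r : seq I) (f : I -> R) :
  (forall i, i \in r -> supp_in S (f i)) -> supp_in S (\sum_(i <- r) f i).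
Proof.
move=> h; rewrite big_seq; apply: (big_ind (supp_in S)) => //.
- by move=> m; rewrite msupp0.
- exact: supp_inD.
Qed.

Lemma supp_inZX (S : 'X_{1..n} -> Prop) (c : K) m : S m -> supp_in S (c *: 'X_[m]).
Proof. by move=> Sm m' /msuppZ_le; rewrite msuppX inE => /eqP->. Qed.

Lemma edge_geM s t f g : supp_in (edge_ge s) f -> supp_in (edge_ge t) g ->
  supp_in (edge_ge (s + t)) (f * g).
Proof.
move=> hf hg m /msuppM_le/allpairsP[[m1 m2] /= [/hf h1 /hg h2 ->]] i j e.
by rewrite !mnmDE; have := h1 _ _ e; have := h2 _ _ e; lia.
Qed.

Lemma cover_edge_ge f : cover_ideal K E f -> supp_in (edge_ge 1) f.
Proof.
case=> s [hs ->]; apply: supp_in_sum => p /hs [C mC ->].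
rewrite -[1%N]add0n; apply: edge_geM => [m _ i j _|m]; first exact: leq0n.
rewrite monomE msuppX inE => /eqP-> i j e; rewrite !mnmE.
have /forallP/(_ i)/forallP/(_ j)/implyP/(_ e) := minsetp mC.
by case: (i \in C); case: (j \in C).
Qed.

(** Threshold covers need not be minimal; their monomials are multiples of those of minimal
    covers. *)
Lemma vertex_cover_ideal C : vertex_cover E C -> cover_ideal K E (monom K C).
Proof.
move=> /minset_exists[D mD DC]; exists [:: (monom K (C :\: D), monom K D)]; split.
  by move=> p; rewrite inE => /eqP->; exists D.
rewrite big_seq1 /= !monomE -mpolyXD; congr mpolyX; apply/mnmP => i.
rewrite mnmDE !mnmE inE; move/subsetP/(_ i): DC.
by case: (i \in D) => [->//|_]; rewrite addn0.
Qed.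

Lemma pow_edge_ge s f : ideal_pow (cover_ideal K E) s f -> supp_in (edge_ge s) f.
Proof.
case=> r [hr ->]; apply: supp_in_sum => p /hr [u [hu ->]].
rewrite -[s in edge_ge s]add0n; apply: edge_geM => [m _ i j _|]; first exact: leq0n.
elim: s u hu {hr} => [|s IH] u hu; first by move=> m _ i j _; exact: leq0n.
rewrite big_ord_recl; apply: (@edge_geM 1 s); first exact/cover_edge_ge.
exact: IH.
Qed.

(* For bipartite [E] a monomial [m] with [s <= m i + m j] on all edges is
   divisible by the product of the [s] covers
   [{i in A | t < m i} + {j notin A | s <= m j + t}], [t < s]. *)
Lemma edge_ge_pow (A : {set 'I_n}) s f :
  (forall i j, E i j -> (i \in A) != (j \in A)) ->
  supp_in (edge_ge s) f -> ideal_pow (cover_ideal K E) s f.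
Proof.
move=> EA hf.
pose C m t := [set i | if i \in A then (t < m i)%N else (s <= m i + t)%N].
have cC m (t : 'I_s) : m \in msupp f -> vertex_cover E (C m t).
  move=> mf; apply/forallP => i; apply/forallP => j; apply/implyP => e.
  have := hf _ mf _ _ e; have := EA _ _ e; have := ltn_ord t.
  by rewrite !inE; case: (i \in A); case: (j \in A) => //= _ _; lia.
(* The exponent of [c m] at [i] is the minimum of [m i] and [s], on either side of the
   bipartition. *)
pose c m := (\sum_(t < s) mnm_of (C m t))%MM.
have cm m : (c m <= m)%MM.
  apply/mnm_lepP => i; rewrite mnm_sumE.
  under eq_bigr do rewrite mnmE inE.
  case: (i \in A).
    have [h|h] := leqP (m i) s; first by rewrite sum_ltn_ord.
    apply: leq_trans (ltnW h); rewrite -[leqRHS](card_ord s) -sum1_card.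
    by apply: leq_sum => t _; case: (_ < _)%N.
  rewrite (eq_bigr (fun t : 'I_s => (s - m i <= t)%N : nat)) => [|t _].
    by rewrite sum_geq_ord; lia.
  by congr nat_of_bool; lia.
exists [seq (f@_m *: 'X_[m - c m], \prod_(t < s) monom K (C m t)) | m <- msupp f].
split=> [p /mapP[m mf ->] /=|].
  by exists (fun t : 'I_s => monom K (C m t)); split=> // t; apply/vertex_cover_ideal/cC.
rewrite big_map {1}[f]mpolyE; apply: eq_bigr => m _ /=.
under [X in _ = _ * X]eq_bigr do rewrite monomE.
by rewrite mprodXE -scalerAl -mpolyXD submK.
Qed.

End CoverPowers.

(** * A lower bound for the Krull dimension *)

Section Dimension.
Variables (K : fieldType) (n : nat).
Local Notation R := {mpoly K[n]}.

Definition zero_vars (j : nat) : n.-tuple R :=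
  [tuple if (l < j)%N then 0 else 'X_l | l < n].

Lemma zero_varsS j f : (f \mPo zero_vars j) \mPo zero_vars j.+1 = f \mPo zero_vars j.+1.
Proof.
rewrite (comp_mpolyEX f (zero_vars j)) raddf_sum comp_mpolyEX /=; apply: eq_bigr => m _.
rewrite comp_mpolyZ !comp_mpolyX rmorph_prod; congr (_ *: _).
apply: eq_bigr => l _; rewrite rmorphXn /=; congr (_ ^+ _).
rewrite !tnth_mktuple; case: ifP => lj; first by rewrite comp_mpoly0 ltnW.
by rewrite comp_mpolyXU -tnth_nth tnth_mktuple.
Qed.

(** The kernels of the substitutions [zero_vars j] form a strict chain of primes, and the
    annihilator of a nonzero element of a domain is zero. *)
Lemma dim_ge_le (I : R -> Prop) i g :
  I g -> g != 0 -> (i <= n)%N -> dim_ge I i.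
Proof.
move=> Ig g0 i_n; exists (fun j f => f \mPo zero_vars j = 0); split.
- move=> j _; split.
  + split=> [|f h f0 h0|f h h0]; first exact: comp_mpoly0.
      by rewrite comp_mpolyD f0 h0 addr0.
    by rewrite rmorphM /= h0 mulr0.
  + by rewrite comp_mpoly1 => /eqP; rewrite oner_eq0.
  + by move=> f h; rewrite rmorphM /= => /eqP; rewrite mulf_eq0 => /orP[]/eqP; [left|right].
- move=> j _ f /(_ g Ig)/eqP; rewrite mulf_eq0 (negPf g0) orbF => /eqP ->.
  exact: comp_mpoly0.
- by move=> j _ f f0; rewrite -zero_varsS f0 comp_mpoly0.
move=> j ji; have jn : (j < n)%N by apply: leq_trans i_n.
exists 'X_(Ordinal jn); rewrite comp_mpolyXU -tnth_nth tnth_mktuple /= ?leqnn // ltnn.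
move/(congr1 (mcoeff U_(Ordinal jn)%MM)); rewrite mcoeffX eqxx mcoeff0.
by move/eqP; rewrite oner_eq0.
Qed.

End Dimension.

(** * Splitting the Cech complex into multidegrees *)

Lemma scale_signM (K : nzRingType) (V : lalgType K) (k : nat) (x : K) (v : V) :
  ((-1) ^+ k * x) *: v = (-1) ^+ k * (x *: v).
Proof. by rewrite -scalerA -signr_odd scaler_sign -[in RHS]signr_odd mulr_sign. Qed.

Section Multidegrees.
Variables (K : fieldType) (n : nat) (E : rel 'I_n) (s : nat).
Local Notation R := {mpoly K[n]}.
Variable I : R -> Prop.
Hypothesis I_supp : forall f, I f <-> supp_in (edge_ge E s) f.
Implicit Types (f g : R) (m : 'X_{1..n}) (F : {set 'I_n}) (a : 'I_n -> int).

Definition frac f m : {fraction R} := tofrac f / tofrac 'X_[m].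

Definition mconst k : 'X_{1..n} := [multinom k | i < n].

(** The multidegree of the monomial [m] divided by the [k]-th power of the product of all
    variables. *)
Definition mshift m k (j : 'I_n) : int := (m j)%:Z - k%:Z.

Definition numerator_ok F t k g := supp_in
  (fun m => F \in covfam E s (mshift m k) /\ \sum_j mshift m k j = t) g.

Lemma X_neq0 m : tofrac ('X_[m] : R) != 0.
Proof.
rewrite tofrac_eq0; apply/eqP => /(congr1 (mcoeff m)).
by rewrite mcoeffX eqxx mcoeff0 => /eqP; rewrite oner_eq0.
Qed.

Lemma frac_inj f g m : frac f m = frac g m -> f = g.
Proof.
move=> /(congr1 (fun z => z * tofrac 'X_[m])).
by rewrite !divfK ?X_neq0 // => /eqP; rewrite tofrac_eq => /eqP.
Qed.

Lemma frac_shift f m u : frac (f * 'X_[u]) (m + u) = frac f m.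
Proof. by rewrite /frac mpolyXD !rmorphM /= -mulf_div divff ?X_neq0 ?mulr1. Qed.

Lemma frac0 m : frac 0 m = 0.
Proof. by rewrite /frac rmorph0 mul0r. Qed.

Lemma sdiff_frac (c : {set 'I_n} -> {fraction R}) (g : {set 'I_n} -> R) m F :
  (forall G, c G = frac (g G) m) -> sdiff c F = frac (sdiff g F) m.
Proof.
move=> cg; rewrite /frac rmorph_sum mulr_suml; apply: eq_bigr => j _.
by rewrite cg rmorphMsign mulrA.
Qed.

Lemma sdiff_coef (g : {set 'I_n} -> R) m F :
  sdiff (fun G => (g G)@_m) F = (sdiff g F)@_m.
Proof.
rewrite /sdiff (raddf_sum (mcoeff m)); apply: eq_bigr => j _.
by rewrite (raddfMsign (mcoeff m)).
Qed.

(** Every large [k] is allowed, so that the finitely many components of a cochain can share one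
    denominator. *)
Lemma loc_deg_num F t z : loc_deg I F t z ->
  exists k0, forall k, (k0 <= k)%N -> exists2 g, numerator_ok F t k g & z = frac g (mconst k).
Proof.
case=> k0 [f [/I_supp If hf ->]]; exists k0 => k k0k.
pose u : 'X_{1..n} := [multinom (if j \in F then k - k0 else k)%N | j < n].
exists (f * 'X_[u]).
  move=> m; rewrite (perm_mem (msuppMX f u)) => /mapP[m0 m0f ->].
  have shE j : mshift (u + m0)%MM k j = (m0 j)%:Z - (k0 * (j \in F))%N%:Z.
    by rewrite /mshift mnmDE mnmE; case: (j \in F); lia.
  split.
    apply/covfamP; split=> [j|i j e iF jF]; first by rewrite shE; case: (j \in F); lia.
    rewrite !shE (negPf iF) (negPf jF).
    by have := If _ m0f _ _ e; lia.
  under eq_bigr do rewrite shE.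
  have := hf _ m0f; rewrite mdegE card_set_sum.
  rewrite sumrB -!(big_morph _ PoszD (erefl 0%:Z)) -big_distrr /= => ->.
  by rewrite addrK.
rewrite monomE mpolyXn -[LHS]/(frac f _) -(frac_shift _ _ u).
congr frac; apply/mnmP => j; rewrite mnmDE mulmnE !mnmE.
by case: (j \in F); lia.
Qed.

Lemma num_loc_deg F t k g : numerator_ok F t k g -> loc_deg I F t (frac g (mconst k)).
Proof.
move=> hg; exists (k + s)%N.
(* Passing to the denominator [monom K F ^+ (k + s)] adds [s] on [F], so each edge meeting [F]
   satisfies its inequality. *)
pose w m : 'X_{1..n} := [multinom (if j \in F then m j + s else m j - k)%N | j < n].
exists (\sum_(m <- msupp g) g@_m *: 'X_[w m]); split.
- apply/I_supp; apply: supp_in_sum => m /hg [/covfamP[h1 h2] _]; apply: supp_inZX => i j e.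
  rewrite !mnmE; case: (boolP (i \in F)) => iF; first by lia.
  case: (boolP (j \in F)) => jF; first by lia.
  by have := h2 _ _ e iF jF; rewrite /mshift; lia.
- apply: supp_in_sum => m /hg [/covfamP[h1 h2] <-]; apply: supp_inZX.
  rewrite mdegE card_set_sum big_distrr /= !(big_morph _ PoszD (erefl 0%:Z)) -big_split /=.
  apply: eq_bigr => j _; rewrite mnmE /mshift.
  case: (boolP (j \in F)) => jF; first by lia.
  have : ~~ (mshift m k j < 0) by apply: contra jF; apply: h1.
  by rewrite /mshift; lia.
rewrite monomE mpolyXn -[RHS]/(frac _ _).
rewrite -(frac_shift g _ (mnm_of F *+ (k + s))%MM) addmC.
rewrite -(frac_shift (\sum_(m <- _) _) _ (mconst k)); congr frac.
rewrite {1}[g]mpolyE !mulr_suml; apply: eq_big_seq => m /hg [/covfamP[h1 h2] _].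
rewrite -!scalerAl -!mpolyXD; congr (_ *: 'X_[_]); apply/mnmP => j.
rewrite !mnmDE mulmnE !mnmE.
case: (boolP (j \in F)) => jF; first by lia.
have : ~~ (mshift m k j < 0) by apply: contra jF; apply: h1.
by rewrite /mshift; lia.
Qed.

Lemma cech_diffE (c : {ffun {set 'I_n} -> {fraction R}}) F :
  cech_diff c F = sdiff c F.
Proof. by rewrite ffunE. Qed.

Lemma cochain_num i t c : cech_cochain I i t c ->
  exists k0, forall k, (k0 <= k)%N -> exists g : {set 'I_n} -> R,
    forall F, [/\ numerator_ok F t k (g F), #|F| != i -> g F = 0 & c F = frac (g F) (mconst k)].
Proof.
move=> cc.
have /fin_all_exists[k0 hk0] F : exists k0, forall k, (k0 <= k)%N -> exists g,
    [/\ numerator_ok F t k g, #|F| != i -> g = 0 & c F = frac g (mconst k)].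
  have := cc F; case: eqP => [_ /loc_deg_num[k0 h]|_ ->].
    by exists k0 => k /h [g hg ->]; exists g.
  by exists 0%N => k _; exists 0; rewrite frac0; split=> // m; rewrite msupp0.
exists (\max_F k0 F)%N => k hk.
have /fin_all_exists[g hg] F := hk0 F k (leq_trans (leq_bigmax F) hk).
by exists g.
Qed.

Lemma num_cochain i t k (g : {set 'I_n} -> R) :
  (forall F, numerator_ok F t k (g F)) -> (forall F, #|F| != i -> g F = 0) ->
  cech_cochain I i t [ffun F => frac (g F) (mconst k)].
Proof.
move=> h1 h2 F; rewrite ffunE; case: eqP => [_|/eqP/h2->]; last exact: frac0.
exact: num_loc_deg.
Qed.

(** By contraposition: primitives of the finitely many monomial components of the numerators are
    assembled into one primitive [h]. *)
Lemma loc_coh_multideg i t : loc_coh_neq0 I i t ->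
  exists2 a, \sum_j a j = t & coh_neq0 K (covfam E s a) i.
Proof.
case=> c [cc dc] nb; apply: NNPP => hn; apply: nb.
have [k0 /(_ _ (leqnn k0)) [g hg]] := cochain_num cc; move: k0 hg => k hg.
have dg F : sdiff g F = 0.
  have /esym := sdiff_frac F (fun G => let: And3 _ _ e := hg G in e).
  by rewrite -cech_diffE dc ffunE -(frac0 (mconst k)) => /frac_inj.
pose N := \max_F msize (g F).
have /fin_all_exists[b hb] (m : 'X_{1..n < N}) : exists b : {set 'I_n} -> K,
    [/\ supported (covfam E s (mshift m k)) b, forall F, b F != 0 -> #|F|.+1 = i,
      forall F, b F != 0 -> \sum_j mshift m k j = t & forall F, sdiff b F = (g F)@_m].
  (* In any other total degree the coefficients of [g] vanish, and the zero primitive serves. *)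
  case: (eqVneq (\sum_j mshift m k j) t) => ht; last first.
    exists (fun=> 0); split=> F; rewrite ?eqxx //.
    rewrite [LHS]big1 => [|j _]; last by rewrite mulr0.
    apply/esym/eqP; rewrite mcoeff_eq0; apply: contra ht => mg.
    by have [/(_ _ mg)[_ ->]] := hg F.
  apply: NNPP => nb; apply: hn; exists (mshift m k) => //.
  exists (fun F => (g F)@_m); split.
  - by move=> F; rewrite -mcoeff_msupp => mg; have [/(_ _ mg)[]] := hg F.
  - move=> F; have [_ h _] := hg F; case: (eqVneq #|F| i) => // /h ->.
    by rewrite mcoeff0 eqxx.
  - by move=> F; rewrite sdiff_coef dg mcoeff0.
  by case=> b [b1 b2 b3]; apply: nb; exists b.
pose h F := \sum_(m : 'X_{1..n < N}) b m F *: 'X_[m] : R.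
have dh F : sdiff h F = g F.
  rewrite [RHS](@mpolywE _ _ N) ?leq_bigmax //.
  under [RHS]eq_bigr => m _ do rewrite -(let: And4 _ _ _ e := hb m in e F) scaler_suml.
  rewrite exchange_big /=; apply: eq_bigr => j _; rewrite mulr_sumr.
  by apply: eq_bigr => m _; rewrite scale_signM.
have h_ok F : numerator_ok F t k (h F).
  apply: supp_in_sum => m _; have [b1 b2 b3 b4] := hb m.
  have [->|bF] := eqVneq (b m F) 0; first by rewrite scale0r => m'; rewrite msupp0.
  by apply: supp_inZX; split; [exact: b1|exact: b3 bF].
have h0 F : #|F|.+1 != i -> h F = 0.
  move=> Fi; apply: big1 => m _; have [_ b2 _ _] := hb m.
  have [->|bF] := eqVneq (b m F) 0; first by rewrite scale0r.
  by rewrite b2 ?eqxx in Fi.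
have dhc F : sdiff [ffun F => frac (h F) (mconst k)] F = c F.
  rewrite (@sdiff_frac _ h (mconst k)) => [|G]; last by rewrite ffunE.
  by rewrite dh; have [_ _ ->] := hg F.
case: i hb h0 hg {cc hn} => [|i] hb h0 hg /=.
  apply/ffunP => F; rewrite -dhc [RHS]ffunE; apply: big1 => j _.
  by rewrite ffunE h0 // frac0 mulr0.
exists [ffun F => frac (h F) (mconst k)]; first by apply: num_cochain => // F Fi; exact: h0.
by apply/ffunP => F; rewrite cech_diffE dhc.
Qed.

(** Inverse to [mshift] for large [k], when [a j + k] is nonnegative and [absz] only changes its
    type. *)
Definition shifted_mnm a k : 'X_{1..n} := [multinom absz (a j + k%:Z)%R | j < n].

Lemma mshift_shifted a k : (\sum_j absz (a j) <= k)%N -> mshift (shifted_mnm a k) k =1 a.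
Proof.
move=> ak j; rewrite /mshift mnmE.
have : (absz (a j) <= k)%N by apply: leq_trans ak; rewrite (bigD1 j) //= leq_addr.
by lia.
Qed.

Lemma shifted_mnmD a k d : (\sum_j absz (a j) <= k)%N ->
  shifted_mnm a (k + d) = (shifted_mnm a k + mconst d)%MM.
Proof.
move=> ak; apply/mnmP => j; rewrite !mnmE.
have : (absz (a j) <= k)%N by apply: leq_trans ak; rewrite (bigD1 j) //= leq_addr.
by lia.
Qed.

(** The scalar cocycle is multiplied by the Laurent monomial of exponent [a]; the matching
    coefficients of a primitive would be a scalar primitive. *)
Lemma multideg_loc_coh i a : coh_neq0 K (covfam E s a) i ->
  loc_coh_neq0 I i (\sum_j a j).
Proof.
case=> c [sc ci dc nb]; set t := \sum_j a j.
pose k := (\sum_j absz (a j))%N.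
pose g k' F : R := c F *: 'X_[shifted_mnm a k'].
have gk' k' F : (k <= k')%N -> frac (g k F) (mconst k) = frac (g k' F) (mconst k').
  move=> kk'; rewrite -(frac_shift _ _ (mconst (k' - k))) /g -(subnKC kk') shifted_mnmD //.
  rewrite -scalerAl -mpolyXD addKn; congr frac; apply/mnmP => j; rewrite !mnmE.
  by rewrite subnKC // addKn.
pose z := [ffun F => frac (g k F) (mconst k)].
have dz F : sdiff z F = 0.
  rewrite (@sdiff_frac _ (g k) (mconst k)) => [|G]; last by rewrite ffunE.
  rewrite -(frac0 (mconst k)); congr frac.
  rewrite -[RHS](scale0r 'X_[shifted_mnm a k]) -(dc F) scaler_suml; apply: eq_bigr => j _.
  by rewrite scale_signM.
exists z.
  split; last by apply/ffunP => F; rewrite cech_diffE dz ffunE.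
  apply: num_cochain => F.
    rewrite /g; have [->|cF] := eqVneq (c F) 0; first by rewrite scale0r => m; rewrite msupp0.
    apply: supp_inZX; rewrite (eq_covfam E s (mshift_shifted (leqnn k))); split; first exact: sc.
    by apply: eq_bigr => j _; rewrite mshift_shifted.
  by rewrite /g; have [->|/ci-> /eqP//] := eqVneq (c F) 0; rewrite scale0r.
case: i ci nb => [|i] ci nb /= zb.
  apply: nb; exists (fun=> 0); split=> F; rewrite ?eqxx //.
  rewrite [LHS]big1 => [|j _]; last by rewrite mulr0.
  move/ffunP/(_ F): zb; rewrite !ffunE -(frac0 (mconst k)) => /frac_inj.
  by move/(congr1 (mcoeff (shifted_mnm a k))); rewrite mcoeffZ mcoeffX eqxx mulr1 mcoeff0 => ->.
case: zb => y yc dy; apply: nb.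
(* [k'] is large enough both for the denominators of [y] and for [shifted_mnm a k'] to represent
   [a]. *)
have [k0 hk0] := cochain_num yc; pose k' := maxn k0 k.
have [h hh] := hk0 k' (leq_maxl _ _).
have kk' : (k <= k')%N := leq_maxr _ _.
exists (fun F => (h F)@_(shifted_mnm a k')); split.
- move=> F; rewrite -mcoeff_msupp => mh; have [/(_ _ mh)[]] := hh F.
  by rewrite (eq_covfam E s (mshift_shifted kk')).
- move=> F; have [_ h0 _] := hh F; case: (eqVneq #|F| i) => [->//|/h0->].
  by rewrite mcoeff0 eqxx.
move=> F; rewrite sdiff_coef.
have -> : sdiff h F = g k' F.
  apply: (@frac_inj _ _ (mconst k')).
  rewrite -(@sdiff_frac y h) => [|G]; last by have [] := hh G.
  by rewrite -cech_diffE dy ffunE (gk' k').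
by rewrite mcoeffZ mcoeffX eqxx mulr1.
Qed.

End Multidegrees.

(** * From maximal values to the regularity of the powers *)

Lemma int_max_exists (P : int -> Prop) (ub v0 : int) :
  P v0 -> (forall v, P v -> v <= ub) ->
  exists2 v, P v & forall v', P v' -> v' <= v.
Proof.
move=> Pv0 Pub; have [k hk] : exists k : nat, ub <= v0 + k%:Z.
  by exists (absz (ub - v0)); lia.
elim: k v0 Pv0 hk => [|k IH] v0 Pv0 hk.
  by exists v0 => // v /Pub; lia.
have [[v [Pv lv]]|h] := classic (exists v, P v /\ v0 < v).
  by apply: IH Pv _; lia.
exists v0 => // v Pv; rewrite leNgt; apply/negP => lv; apply: h; by exists v.
Qed.

Section RegPowers.
Variables (K : fieldType) (n : nat) (E : rel 'I_n) (A : {set 'I_n}).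
Hypothesis E_simple : simple_graph E.
Hypothesis EA : forall i j, E i j -> (i \in A) != (j \in A).
Local Notation J s := (ideal_pow (cover_ideal K E) s).
Local Notation V s := (reg_value E K s).

Lemma cover_powP s f : J s f <-> supp_in (edge_ge E s) f.
Proof. by split; [exact: pow_edge_ge | exact: edge_ge_pow EA]. Qed.

(** Classes in degree [t] correspond to multidegrees of sum [t]. A lower bound on the dimension is
    enough, since nonzero cohomology occurs only for [i <= n]. *)
Lemma max_reg_value_is_reg s r :
  V s r -> (forall v, V s v -> v <= r) -> is_reg (J s) r.
Proof.
move=> [a0 [i0 [c0 e0]]] rmax.
have dimJ i : (i <= n)%N -> dim_ge (J s) i.
  (* The [s]-th power of the product of all variables is a nonzero element of [J s]. *)
  apply: (@dim_ge_le _ _ _ _ 'X_[mconst n s]).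
    apply/cover_powP => m; rewrite msuppX inE => /eqP-> i' j _; rewrite !mnmE; lia.
  by rewrite -tofrac_eq0 X_neq0.
have ub i t : loc_coh_neq0 (J s) i t -> t + i%:Z <= r.
  by move=> /(loc_coh_multideg (cover_powP s))[a <- ci]; apply: rmax; exists a, i.
split=> [|i _].
  exists i0, (\sum_j a0 j); split=> //.
    apply: dimJ; have [F _ <-] := coh_neq0_supp c0.
    by rewrite -[leqRHS](card_ord n) max_card.
  split; first exact: multideg_loc_coh (cover_powP s) _ _ c0.
  move=> t' /(loc_coh_multideg (cover_powP s))[a ea ci].
  have := rmax (t' + i0%:Z); rewrite e0 lerD2r; apply.
  by exists a, i0; rewrite ea.
have [[t ht]|h] := classic (exists t, loc_coh_neq0 (J s) i t).
  have [|t1 ht1 t1max] := @int_max_exists _ (r - i%:Z) _ ht.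
    by move=> t' /ub; lia.
  by exists (Some t1) => //; exact: ub.
by exists None => // t ht; apply: h; exists t.
Qed.

(** One inequality shrinks a maximal value, the other stretches one; [reg_value_cover] supplies the
    lower bound on [r] that stretching requires. *)
Lemma max_reg_value_succ p r r' : (n < p)%N ->
  V p.+1 r -> (forall v, V p.+1 v -> v <= r) ->
  V p.+2 r' -> (forall v, V p.+2 v -> v <= r') -> r' = r + (max_cover E)%:Z.
Proof.
move=> np Vr rmax Vr' rmax'; apply/eqP; rewrite eq_le; apply/andP; split.
  by have [v /rmax] := reg_value_down E_simple EA (ltnW np) Vr'; lia.
apply: rmax'; apply: (reg_value_up E_simple EA) => //; apply: rmax.
by case: p np {Vr Vr'} => // p _; exact: reg_value_cover.
Qed.

End RegPowers.

Theorem corollary3p4 (K : fieldType) (n : nat) (E : rel 'I_n)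
  (E_simple : simple_graph E) (E_bip : bipartite E) :
  exists d e : int, forall s : nat, (n + 2 <= s)%N ->
    is_reg (ideal_pow (cover_ideal K E) s) (d * s%:Z + e).
Proof.
have [A EA] := E_bip.
have ex p : exists2 r, reg_value E K p.+2 r & forall v, reg_value E K p.+2 v -> v <= r.
  apply: int_max_exists (reg_value_cover K E_simple p) _ => v.
  exact: (reg_value_le E_simple EA).
have [r0 Vr0 r0max] := ex n.
(* The constant term is fixed by the maximal value [r0] at [s = n + 2]. *)
exists (max_cover E)%:Z, (r0 - (max_cover E)%:Z * n.+2%:Z) => s ns.
have [k ->] : exists k, s = (n + k).+2 by exists (s - n.+2)%N; lia.
have [] : reg_value E K (n + k).+2 (r0 + (max_cover E)%:Z * k%:Z) /\
  forall v, reg_value E K (n + k).+2 v -> v <= r0 + (max_cover E)%:Z * k%:Z.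
  elim: k => [|k [IH1 IH2]]; first by rewrite addn0 mulr0 addr0.
  have [r Vr rmax] := ex (n + k.+1)%N; rewrite addnS in Vr rmax *.
  (* Here [p = n + k + 1], so starting at [s = n + 2] is what gives [n < p]. *)
  have e := max_reg_value_succ E_simple EA (leq_addr k n : (n < (n + k).+1)%N) IH1 IH2 Vr rmax.
  suff <- : r = r0 + (max_cover E)%:Z * k.+1%:Z by [].
  by rewrite e; lia.
move=> Vk kmax; rewrite [X in is_reg _ X](_ : _ = r0 + (max_cover E)%:Z * k%:Z).
  exact: max_reg_value_is_reg EA _ _ Vk kmax.
by rewrite -2!addSn PoszD mulrDr addrC addrA subrK.
Qed.
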